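(* Let $n\ge1$, let $R,L\subseteq\{0,1,\dots,n-1\}$, let $S_1=\{a^{2r}\mid r\in R\}\cup\{a^{2l}b,\ a^{-2l}b^2\mid l\in L\}$, and let $S_2\subseteq \langle a^2\rangle a\cup\langle a^2\rangle ab\cup\langle a^2\rangle ab^2$, such that $S=S_1\cup S_2$ satisfies $1\notin S=S^{-1}$. Put $S_R=\{a^{2r}\mid r\in R\}$ and $S_L=\{a^{2l}\mid l\in L\}$ and assume $S_L=S_L^{-1}$. Then $\mathrm{Cay}(U_{6n},S)$ is integral if and only if both of the following hold for all $0\le j\le 2n-1$ and $0\le k\le n-1$: (1) $3\rho_j(S_R)+\chi_j(S_2)$ and $3\rho_j(S_L)+\chi_j(S_2)$ are integers; (2) $2\psi_k(S_2^2)$ is a perfect square (the square of an integer).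
   Context: For an integer $n\ge1$, $U_{6n}=\langle a,b\mid a^{2n}=b^3=1,\ a^{-1}ba=b^{-1}\rangle$, a group of order $6n$ whose elements are uniquely $a^ib^\epsilon$ with $0\le i\le 2n-1$, $\epsilon\in\{0,1,2\}$. Let $\omega=\exp(\pi\imath/n)$. Its irreducible complex characters are: the $2n$ linear characters $\chi_j$ ($0\le j\le 2n-1$) given by $\chi_j(a^{2r}b^\epsilon)=\omega^{2jr}$ and $\chi_j(a^{2r+1}b^\epsilon)=\omega^{j(2r+1)}$ for all $\epsilon\in\{0,1,2\}$; and the $n$ degree-two characters $\psi_k$ ($0\le k\le n-1$) given by $\psi_k(a^{2r})=2\omega^{2kr}$, $\psi_k(a^{2r}b)=\psi_k(a^{2r}b^2)=-\omega^{2kr}$, $\psi_k(a^{2r+1}b^\epsilon)=0$. The irreducible characters of the cyclic subgroup $\langle a\rangle$ (order $2n$) are $\rho_j$, $0\le j\le 2n-1$, with $\rho_j(a^m)=\omega^{jm}$. For a character $\chi$ and subsets $A$ of a group, $\chi(A)=\sum_{x\in A}\chi(x)$ (with $\chi(\emptyset)=0$) and $\chi(A^2)=\sum_{x_1,x_2\in A}\chi(x_1x_2)$, the sum running over all ordered pairs. For a group $G$ and $S\subseteq G$ with $1\notin S=S^{-1}$, the Cayley graph $\mathrm{Cay}(G,S)$ has vertex set $G$ and edges $\{g,sg\}$ for $g\in G,s\in S$. A graph is integral if all eigenvalues of its adjacency matrix are integers. *)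

(* Defs.v *)
From HB Require Import structures.
From mathcomp Require Import all_boot all_order all_algebra all_field.
Set Implicit Arguments. Unset Strict Implicit. Unset Printing Implicit Defensive.
Import Order.TTheory GRing.Theory Num.Theory.
Local Open Scope ring_scope.

(* The group U_{6n} (for n >= 1), elements a^i b^e encoded as pairs (i, e),
   i in 'I_(2n), e in 'I_3.  We write 2n as (n.-1).*2.+2 so that inZp is
   available; for n >= 1 this is exactly 2n. *)
Definition two_n (n : nat) : nat := (n.-1).*2.+2.
Definition U (n : nat) : finType := ('I_(two_n n) * 'I_3)%type.

Definition oneU (n : nat) : U n := (inZp 0, inZp 0).
(* (a^i b^e)(a^j b^f) = a^(i+j) b^((-1)^j e + f), since b^e a^j = a^j b^((-1)^j e) *)
Definition mulU (n : nat) (x y : U n) : U n :=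
  (inZp (x.1 + y.1), inZp ((if odd y.1 then 2 * x.2 else x.2) + y.2)).
(* (a^i b^e)^-1 = a^(-i) b^(-(-1)^i e) *)
Definition invU (n : nat) (x : U n) : U n :=
  (inZp (two_n n - x.1), inZp (if odd x.1 then x.2 : nat else 2 * x.2)).

Definition apow (n m : nat) : U n := (inZp m, inZp 0).
Definition apowb (n m e : nat) : U n := (inZp m, inZp e).

Definition invS (n : nat) (A : {set U n}) : {set U n} := [set invU x | x in A].

(* omega = exp(pi i / n): n.-root (-1) in algC is the n-th root of -1 with
   minimal nonnegative argument, i.e. exp(pi i / n). *)
Definition omega (n : nat) : algC := n.-root (-1).

Definition chiU (n j : nat) (x : U n) : algC := omega n ^+ (j * x.1).
Definition psiU (n k : nat) (x : U n) : algC :=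
  if odd x.1 then 0
  else if x.2 == 0 :> nat then 2 * omega n ^+ (k * x.1)
  else - omega n ^+ (k * x.1).
(* irreducible characters rho_j of <a>: rho_j(a^m) = omega^(j m) *)
Definition rhoU (n j : nat) (x : U n) : algC := omega n ^+ (j * x.1).

Definition charS (n : nat) (f : U n -> algC) (A : {set U n}) : algC :=
  \sum_(x in A) f x.
Definition charS2 (n : nat) (f : U n -> algC) (A : {set U n}) : algC :=
  \sum_(x1 in A) \sum_(x2 in A) f (mulU x1 x2).

Definition cay_adj (n : nat) (S : {set U n}) : 'M[algC]_(#|U n|) :=
  \matrix_(i, j) (if mulU (enum_val j) (invU (enum_val i)) \in S then 1 else 0).

Definition integral_graph (n : nat) (S : {set U n}) : Prop :=
  forall lam : algC, eigenvalue (cay_adj S) lam -> lam \in Num.int.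

Definition is_square (x : algC) : Prop := exists z : int, x = (z ^+ 2)%:~R.

Arguments chiU : clear implicits. Arguments psiU : clear implicits.
Arguments rhoU : clear implicits. Arguments oneU : clear implicits.

(* Main.v *)
Require Import Defs.
From HB Require Import structures.
From mathcomp Require Import all_boot all_order all_algebra all_field.
From mathcomp Require Import ring zify.
Import Order.TTheory GRing.Theory Num.Theory.
Local Open Scope ring_scope.

(** Let zeta be a primitive cube root of unity.  The functions
    phi_(m,c) (a^i b^e) = omega^(m i) zeta^(c e) form a Fourier basis of the
    functions on U_(6n), and the span of the restrictions of phi_(m,c) to the even
    and to the odd powers of a is stable under the adjacency operator, which acts
    there as D + [[0, u], [v, 0]] with D the sum of phi_(m,c) over the even part of
    S and u, v the sums of phi_(m,c), phi_(m,-c) over S_2.  So the eigenvalues are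
    the roots of (X - D)^2 = u v.  For c = 0 they are
    rho(S_R) + 2 rho(S_L) +- chi(S_2), and for c = 1, 2 they are
    rho(S_R) - rho(S_L) +- sqrt(psi(S_2^2) / 2).  As all these sums are algebraic
    integers, rational means integral, and both conditions can be solved for one
    another linearly.  That the phi_(m,c) are independent requires omega, defined
    by extremality of its argument, to be a primitive 2n-th root of unity. *)

(** * Roots of unity of maximal real part, and the order of [omega] *)

Lemma unity_root_norm1 (N : nat) (x : algC) :
  (0 < N)%N -> x ^+ N = 1 -> `|x| = 1.
Proof.
move=> N_gt0 /(congr1 Num.norm); rewrite normrX normr1 => /eqP.
by rewrite pexpr_eq1 // => /eqP.
Qed.

Lemma norm1_Re_Im (x : algC) : `|x| = 1 -> 'Re x ^+ 2 + 'Im x ^+ 2 = 1.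
Proof. by move=> nx; rewrite -normC2_Re_Im nx expr1n. Qed.

Lemma norm1_Re_lt1 (x : algC) : `|x| = 1 -> x != 1 -> 'Re x < 1.
Proof.
move=> nx x1.
have Rle : 'Re x <= 1 by rewrite -nx leif_Re_Creal.
rewrite lt_neqAle Rle andbT; apply: contra x1 => /eqP r1.
have := norm1_Re_Im _ nx; rewrite r1 expr1n -[RHS]addr0 => /addrI/eqP.
by rewrite sqrf_eq0 => /eqP i0; rewrite [x]Crect r1 i0 mulr0 addr0.
Qed.

(* The addition formulas for cosine, applied to the rotations of [x] by the angle
   of [y] in both directions. *)
Lemma rotation_increases_Re (x y : algC) :
  `|x| = 1 -> `|y| = 1 -> 'Re y < 1 -> 'Re x <= 'Re y ->
  'Re (x * y) <= 'Re x -> 'Re (x * y^*) <= 'Re x -> False.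
Proof.
move=> /norm1_Re_Im nx /norm1_Re_Im ny y_lt1 le_xy.
rewrite !ReM Re_conj Im_conj.
set c := 'Re x in nx le_xy *; set d := 'Re y in ny y_lt1 le_xy *.
set s := 'Im x in nx *; set t := 'Im y in ny *.
rewrite mulrN opprK => h1 h2.
have d1 : 0 < 1 - d by rewrite subr_gt0.
(* The hypotheses [h1] and [h2] add up to 2c(1 - d) >= 0. *)
have c_ge0 : 0 <= c.
  have h : 0 <= c * (1 - d) *+ 2.
    have -> : c * (1 - d) *+ 2 = (c - (c * d - s * t)) + (c - (c * d + s * t)).
      by ring.
    by rewrite addr_ge0 // subr_ge0.
  by move: h; rewrite pmulrn_lge0 // pmulr_lge0.
have h : 0 <= (c - (c * d - s * t)) * (c - (c * d + s * t)).
  by rewrite mulr_ge0 // subr_ge0.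
have E : (c - (c * d - s * t)) * (c - (c * d + s * t))
   = (1 - d) * (c ^+ 2 *+ 2 - 1 - d).
  have -> : (c - (c * d - s * t)) * (c - (c * d + s * t))
   = (c * (1 - d)) ^+ 2 - s ^+ 2 * t ^+ 2 by ring.
  have -> : s ^+ 2 = 1 - c ^+ 2 by rewrite -nx; ring.
  have -> : t ^+ 2 = 1 - d ^+ 2 by rewrite -ny; ring.
  by ring.
move: h; rewrite E pmulr_rge0 // => h.
(* Since 0 <= c <= d < 1 this sum is positive, yet it equals 1 + d - 2c^2, which [h] makes
   nonpositive. *)
have : 0 < (c * (1 - c) + (d - c)) *+ 2 + (1 - d).
  apply: ltr_wpDl => //; apply: mulrn_wge0; apply: addr_ge0; last by rewrite subr_ge0.
  apply: mulr_ge0 => //; rewrite subr_ge0; apply: ltW; exact: le_lt_trans le_xy _.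
have -> : (c * (1 - c) + (d - c)) *+ 2 + (1 - d) = - (c ^+ 2 *+ 2 - 1 - d) by ring.
by rewrite oppr_gt0 => /lt_le_trans/(_ h); rewrite ltxx.
Qed.

Lemma conj_unity_root (N : nat) (x : algC) :
  (0 < N)%N -> x ^+ N = 1 -> x^* = x^-1.
Proof.
by move=> N0 xN; rewrite invC_norm (unity_root_norm1 _ _ N0 xN) expr1n invr1 mul1r.
Qed.

(* If the powers of [y] missed some root of unity, take such an [x] of maximal
   real part: rotating [x] towards 1 by [y] would give a better one. *)
Lemma max_Re_unity_root (N : nat) : (1 < N)%N ->
  exists2 y : algC, N.-primitive_root y &
    forall x : algC, x ^+ N = 1 -> x != 1 -> 'Re x <= 'Re y.
Proof.
move=> N_gt1; have N_gt0 := ltnW N_gt1.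
have [z prim_z] := C_prim_root_exists N_gt0.
have z_eq1 (i : 'I_N) : (z ^+ i == 1) = (i == 0 :> nat).
  rewrite -(prim_order_dvd prim_z); apply/idP/eqP => [|-> //].
  move=> /dvdn_leq; case: (nat_of_ord i) (ltn_ord i) => // k kN /(_ isT).
  by rewrite leqNgt kN.
have powzN i : (z ^+ i) ^+ N = 1 by rewrite exprAC (prim_expr_order prim_z) expr1n.
pose P (i : 'I_N) := z ^+ i != 1.
have P1 : P (Ordinal N_gt1) by rewrite /P z_eq1.
have Rz (Q : pred 'I_N) : {in Q, forall i : 'I_N, 'Re (z ^+ i) \is Num.real}.
  by move=> i _; exact: Creal_Re.
case: (real_arg_maxP P1 (Rz P)) => t Pt t_max.
set y := z ^+ t in Pt t_max.
have y_max x : x ^+ N = 1 -> x != 1 -> 'Re x <= 'Re y.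
  by move=> /(prim_rootP prim_z)[i ->] xi; exact: t_max.
exists y => //.
have yN : y ^+ N = 1 by exact: powzN.
have [d prim_y d_dvd] := prim_order_exists N_gt0 yN.
suff zd : z ^+ d = 1.
  have : (N %| d)%N by rewrite (prim_order_dvd prim_z) zd.
  by move=> N_dvd; rewrite (_ : N = d) //; apply/eqP; rewrite eqn_dvd N_dvd.
apply/eqP/negPn/negP => zd.
(* As [y] has order [d], [Q] marks the roots outside the group generated by [y]. Multiplication by a
   d-th root of unity stays outside, which gives [step]. *)
pose Q (i : 'I_N) := (z ^+ i) ^+ d != 1.
have Q1 : Q (Ordinal N_gt1) by rewrite /Q.
case: (real_arg_maxP Q1 (Rz Q)) => u Qu u_max.
set x := z ^+ u in Qu u_max.
have xN : x ^+ N = 1 by exact: powzN.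
have x1 : x != 1 by apply: contra Qu => /eqP xe; rewrite /Q -/x xe expr1n.
have yd : y ^+ d = 1 by exact: prim_expr_order.
have step w : w ^+ N = 1 -> w ^+ d = 1 -> 'Re (x * w) <= 'Re x.
  move=> wN wd; have : (x * w) ^+ N = 1 by rewrite exprMn xN wN mulr1.
  case/(prim_rootP prim_z) => i Ei; rewrite Ei; apply: u_max.
  by rewrite /Q -Ei exprMn wd mulr1.
apply: (rotation_increases_Re x y).
- exact: unity_root_norm1 xN.
- exact: unity_root_norm1 yN.
- by apply: norm1_Re_lt1 => //; exact: unity_root_norm1 yN.
- exact: y_max.
- exact: step.
- by rewrite (conj_unity_root _ _ N_gt0 yN); apply: step; rewrite exprVn ?yN ?yd invr1.
Qed.

Lemma omega_expn (n : nat) : (0 < n)%N -> omega n ^+ n = -1.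
Proof. by move=> n0; rewrite /omega rootCK. Qed.

(** Let [y] be a primitive root of maximal real part among the nontrivial 2n-th roots of unity. Then
    y^n = -1, and one of [y] and its conjugate lies in the closed upper half-plane, where [omega n]
    has the largest real part among the n-th roots of -1. Hence [omega n] and [y] have equal real
    parts, so [omega n] is [y] or its conjugate. *)
Lemma omega_prim (n : nat) : (0 < n)%N -> (2 * n).-primitive_root (omega n).
Proof.
move=> n_gt0; have N_gt1 : (1 < 2 * n)%N by lia.
have N_gt0 := ltnW N_gt1.
have [y prim_y y_max] := max_Re_unity_root _ N_gt1.
have wn := omega_expn _ n_gt0; set w := omega n in wn *.
have wN : w ^+ (2 * n) = 1 by rewrite mulnC exprM wn sqrrN expr1n.
have w1 : w != 1.
  apply/eqP => w1; move/eqP: wn; rewrite w1 expr1n eq_sym -subr_eq0 -opprD oppr_eq0.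
  by rewrite (_ : 1 + 1 = 2%:R) ?pnatr_eq0 // -natrD.
have yN := prim_expr_order prim_y.
have yn : y ^+ n = -1.
  have : (y ^+ n) ^+ 2 == 1 by rewrite -exprM mulnC yN.
  rewrite sqrf_eq1 -(prim_order_dvd prim_y) => /orP[/dvdn_leq|/eqP //].
  by move=> /(_ n_gt0); rewrite mul2n -addnn -{3}[n]addn0 leq_add2l leqNgt n_gt0.
have Re_eq : 'Re w = 'Re y.
  apply/le_anti; rewrite y_max //=.
  have Iy := Creal_Im y; case/real_ge0P: Iy => Iy; first exact: rootC_Re_max.
  rewrite -Re_conj; apply: rootC_Re_max => //.
    by rewrite -rmorphXn yn rmorphN rmorph1.
  by rewrite Im_conj oppr_ge0 ltW.
have Im_eq : 'Im w ^+ 2 == 'Im y ^+ 2.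
  have := norm1_Re_Im _ (unity_root_norm1 _ _ N_gt0 wN).
  rewrite -(norm1_Re_Im _ (unity_root_norm1 _ _ N_gt0 yN)) Re_eq.
  by move/addrI => ->.
move: Im_eq; rewrite eqf_sqr => /orP[] /eqP Im_eq.
  by rewrite [w]Crect Re_eq Im_eq -Crect.
have -> : w = y^*.
  by rewrite [w]Crect Re_eq Im_eq -Re_conj -Im_conj -Crect.
by rewrite fmorph_primitive_root.
Qed.

(** * Parity and cancellation in U_(6n) *)

Lemma two_nE (n : nat) : (0 < n)%N -> two_n n = (2 * n)%N.
Proof. by rewrite /two_n; lia. Qed.

Lemma odd_modn_two_n (n m : nat) : odd (m %% two_n n) = odd m.
Proof.
rewrite {2}(divn_eq m (two_n n)) oddD oddM.
by rewrite /two_n /= negbK odd_double andbF.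
Qed.

Lemma odd_mulU (n : nat) (x y : U n) :
  odd (mulU x y).1 = odd x.1 (+) odd y.1.
Proof. by rewrite /= odd_modn_two_n oddD. Qed.

Lemma odd_invU (n : nat) (x : U n) : odd (invU x).1 = odd x.1.
Proof.
rewrite /= odd_modn_two_n oddB; last exact/ltnW/ltn_ord.
by rewrite /two_n /= negbK odd_double.
Qed.

(** Serves to write the neighbours of [g] as products s g with s in the connection set. *)
Lemma mulUK (n : nat) (g : U n) :
  cancel (fun x : U n => mulU x g) (fun x => mulU x (invU g)).
Proof.
move=> x; rewrite [RHS]surjective_pairing; congr pair; apply/val_inj => /=.
  rewrite modnDml modnDmr.
  rewrite -addnA subnKC; last exact/ltnW/ltn_ord.
  by rewrite modnDr modn_small.
have := odd_invU _ g; rewrite /= => ->.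
case: (x.2) (g.2) => [a +] [b +]; case: odd => /=; rewrite /Zp_trunc /=.
  by case: a => [|[|[|]]] //; case: b => [|[|[|]]].
by case: a => [|[|[|]]] //; case: b => [|[|[|]]].
Qed.

(** * The Fourier functions [phi] under multiplication *)

Definition zeta : algC := omega 3 ^+ 2.

Lemma zeta_prim : 3.-primitive_root zeta.
Proof. exact: (exp_prim_root (omega_prim 3 isT) 2). Qed.

Lemma prim_root_neq0 (N : nat) (z : algC) : N.-primitive_root z -> z != 0.
Proof.
move=> pz; rewrite -normr_gt0 (unity_root_norm1 N) //.
  exact: prim_order_gt0 pz.
exact: prim_expr_order.
Qed.

Definition phi (n m c : nat) (x : U n) : algC :=
  omega n ^+ (m * x.1) * zeta ^+ (c * x.2).

Lemma expr_mulmod (R : nzRingType) (N : nat) (z : R) (m i : nat) :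
  N.-primitive_root z -> z ^+ (m * (i %% N)) = z ^+ (m * i).
Proof. by move=> pz; rewrite -(prim_expr_mod pz) modnMmr (prim_expr_mod pz). Qed.

Lemma omega_prim_two_n (n : nat) : (0 < n)%N -> (two_n n).-primitive_root (omega n).
Proof. by move=> n0; rewrite two_nE //; exact: omega_prim. Qed.

(* [2 * x.2] in [mulU] is a product in ['I_3], read back as a natural number. *)
Lemma val_double_ord3 (e : 'I_3) : (2 * e)%R = (2 * e %% 3)%N :> nat.
Proof. by case: e => [[|[|[|]]]]. Qed.

(** Moving b^e past an odd power of a inverts it, so the left factor is seen at the opposite
    frequency, written [2 * c]. *)
Lemma phi_mulU (n m c : nat) (s g : U n) : (0 < n)%N ->
  phi n m c (mulU s g) = phi n m (if odd g.1 then 2 * c else c)%N s * phi n m c g.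
Proof.
move=> n0; rewrite /phi /= (expr_mulmod _ _ _ _ _ zeta_prim).
rewrite (expr_mulmod _ _ _ _ _ (omega_prim_two_n _ n0)).
rewrite mulnDr exprD mulnDr exprD mulrACA; congr (_ * _ * (_ * _)).
case: odd => //; rewrite val_double_ord3 (expr_mulmod _ _ _ _ _ zeta_prim).
by rewrite mulnA (mulnC c).
Qed.

Lemma phi_neq0 (n m c : nat) (x : U n) : (0 < n)%N -> phi n m c x != 0.
Proof.
move=> n0; rewrite mulf_neq0 // expf_neq0 //.
  exact: prim_root_neq0 (omega_prim_two_n _ n0).
exact: prim_root_neq0 zeta_prim.
Qed.

(* Since [zeta ^+ 3 = 1], the opposite of the frequency [c] is [2 * c]. *)
Definition even_coef {n : nat} (S : {set U n}) (m c : nat) : algC :=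
  \sum_(s in S | ~~ odd s.1) phi n m c s.
Definition odd_coef {n : nat} (S : {set U n}) (m c : nat) : algC :=
  \sum_(s in S | odd s.1) phi n m c s.

(** * Adjacency operator on the span of the two parity restrictions of [phi] *)

Definition wave (n m c : nat) (a b : algC) (x : U n) : algC :=
  (if odd x.1 then b else a) * phi n m c x.

(** Even s keep the parity of g and odd s flip it, which exchanges the amplitudes [a] and [b]; the
    parity of g decides between the frequencies [c] and [2 * c]. *)
Lemma sum_wave (n m c : nat) (a b : algC) (S : {set U n}) (g : U n) : (0 < n)%N ->
  \sum_(s in S) wave n m c a b (mulU s g) =
  (if odd g.1 then a * odd_coef S m (2 * c) + b * even_coef S m (2 * c)
   else a * even_coef S m c + b * odd_coef S m c) * phi n m c g.
Proof.
move=> n0; rewrite (bigID (fun s : U n => odd s.1)) /=.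
under eq_bigr => s /andP[_ odds] do
  rewrite /wave odd_mulU odds phi_mulU // mulrA.
under [X in _ + X]eq_bigr => s /andP[_ odds] do
  rewrite /wave odd_mulU (negPf odds) phi_mulU // mulrA.
rewrite -!mulr_suml -!mulr_sumr -mulrDl; congr (_ * _).
by case: (odd g.1) => //=; rewrite addrC.
Qed.

Definition wave_col (n : nat) (w : U n -> algC) : 'cV[algC]_#|U n| :=
  \col_i w (enum_val i).

Lemma cay_adj_col (n : nat) (S : {set U n}) (w : U n -> algC) :
  cay_adj S *m wave_col n w = wave_col n (fun g => \sum_(s in S) w (mulU s g)).
Proof.
apply/colP => i; rewrite !mxE; set g := enum_val i.
under eq_bigr do rewrite !mxE.
rewrite -(big_enum_val (fun h => (if mulU h (invU g) \in S then 1 else 0) * w h)) /=.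
rewrite (reindex_inj (can_inj (mulUK _ g))) /= [RHS]big_mkcond.
by apply: eq_bigr => s _; rewrite mulUK; case: ifP; rewrite ?mul1r ?mul0r.
Qed.

(** The predicate [eigenvalue] refers to row vectors; a matrix and its transpose have the same
    characteristic polynomial. *)
Lemma eigenvalue_col (F : fieldType) (N : nat) (A : 'M[F]_N) (lam : F) (w : 'cV_N) :
  A *m w = lam *: w -> w != 0 -> eigenvalue A lam.
Proof.
move=> Aw w0; rewrite eigenvalue_root_char.
have -> : char_poly A = char_poly A^T.
  rewrite /char_poly -det_tr; congr (\det _).
  by apply/matrixP => i j; rewrite !mxE eq_sym.
rewrite -eigenvalue_root_char; apply/eigenvalueP; exists w^T.
  by rewrite -trmx_mul Aw linearZ.
by rewrite trmx_eq0.
Qed.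

Lemma eq_wave_col (n : nat) (w w' : U n -> algC) :
  w =1 w' -> wave_col n w = wave_col n w'.
Proof. by move=> E; apply/colP => i; rewrite !mxE E. Qed.

Lemma cay_adj_wave (n : nat) (S : {set U n}) (m c : nat) (a b D : algC) :
  (0 < n)%N -> even_coef S m c = D -> even_coef S m (2 * c) = D ->
  cay_adj S *m wave_col n (wave n m c a b) =
  wave_col n (wave n m c (a * D + b * odd_coef S m c)
                         (a * odd_coef S m (2 * c) + b * D)).
Proof.
move=> n0 ev ev2; rewrite cay_adj_col; apply: eq_wave_col => g.
by rewrite sum_wave // ev ev2 /wave; case: odd.
Qed.

Lemma wave_eigenvalue (n : nat) (S : {set U n}) (m c : nat) (a b D mu : algC) :
  (0 < n)%N -> even_coef S m c = D -> even_coef S m (2 * c) = D ->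
  b * odd_coef S m c = mu * a -> a * odd_coef S m (2 * c) = mu * b ->
  (a != 0) || (b != 0) -> eigenvalue (cay_adj S) (D + mu).
Proof.
move=> n0 ev ev2 eqa eqb ab0.
apply: (@eigenvalue_col _ _ _ _ (wave_col n (wave n m c a b))).
  rewrite (cay_adj_wave _ _ _ _ _ _ D) // eqa eqb; apply/colP => i; rewrite !mxE /wave.
  by case: odd; ring.
have nz x : wave n m c a b x != 0 -> wave_col n (wave n m c a b) != 0.
  apply: contraNneq => /colP/(_ (enum_rank x)).
  by rewrite !mxE enum_rankK => ->.
(* As [phi] has no zero, it suffices to evaluate at the identity for [a] and at the generator a for
   [b]. *)
case/orP: ab0 => [a0|b0].
  by apply: (nz (apow n 0)); rewrite /wave /= mulf_neq0 ?phi_neq0.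
by apply: (nz (apow n 1)); rewrite /wave /= mulf_neq0 ?phi_neq0.
Qed.

(** For u and v the two odd coefficients, (u, mu) is an eigenvector of [[0, u], [v, 0]] unless u =
    0; in that case mu = 0 and (0, 1) lies in the kernel. *)
Lemma square_eigenvalue (n : nat) (S : {set U n}) (m c : nat) (D mu : algC) :
  (0 < n)%N -> even_coef S m c = D -> even_coef S m (2 * c) = D ->
  mu ^+ 2 = odd_coef S m c * odd_coef S m (2 * c) ->
  eigenvalue (cay_adj S) (D + mu).
Proof.
move=> n0 ev ev2 mu2; have [u0|u0] := eqVneq (odd_coef S m c) 0.
  move: mu2; rewrite u0 mul0r => /eqP; rewrite sqrf_eq0 => /eqP mu0.
  apply: (wave_eigenvalue _ _ m c 0 1) => //; rewrite ?oner_neq0 ?orbT //.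
    by rewrite u0 !mulr0.
  by rewrite mu0 !mul0r.
apply: (wave_eigenvalue _ _ m c (odd_coef S m c) mu) => //.
by rewrite u0.
Qed.

(** * Fourier inversion and completeness of the list of eigenvalues *)

Lemma sum_expr_unity (N : nat) (z : algC) : z ^+ N = 1 ->
  \sum_(k < N) z ^+ k = if z == 1 then N%:R else 0.
Proof.
move=> zN; have [->|z1] := eqVneq z 1.
  by under eq_bigr do rewrite expr1n; rewrite sumr_const card_ord.
by apply: (mulfI (_ : z - 1 != 0)); rewrite ?subr_eq0 // mulr0 -subrX1 zN subrr.
Qed.

(** The summand is p^k q^c with q^3 = 1. Equal parity of the exponents of a yields p^n = 1 because
    omega^n = -1, so the double sum is a product of two full geometric sums. *)
Lemma phi_orthogonality (n : nat) (x y : U n) : (0 < n)%N -> odd x.1 = odd y.1 ->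
  \sum_(k < n) \sum_(c < 3) phi n k c x / phi n k c y =
  if x == y then (n * 3)%:R else 0.
Proof.
move=> n0 oxy; pose p := omega n ^+ x.1 / omega n ^+ y.1.
pose q := zeta ^+ x.2 / zeta ^+ y.2.
have E k c : phi n k c x / phi n k c y = p ^+ k * q ^+ c.
  by rewrite /phi /p /q invfM mulrACA !expr_div_n -!exprM !(mulnC k) !(mulnC c).
under eq_bigr => k _ do under eq_bigr => c _ do rewrite E.
under eq_bigr => k _ do rewrite -mulr_sumr.
have om_i i : (omega n ^+ i) ^+ n = (-1) ^+ odd i.
  by rewrite exprAC omega_expn // signr_odd.
have pn : p ^+ n = 1.
  by rewrite exprMn exprVn !om_i oxy divff // signr_eq0.
have q3 : q ^+ 3 = 1.
  rewrite exprMn exprVn ![(zeta ^+ _) ^+ 3]exprAC (prim_expr_order zeta_prim).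
  by rewrite !expr1n divff ?oner_neq0.
have eq1 N (z : algC) (i j : 'I_N) :
    N.-primitive_root z -> (z ^+ i / z ^+ j == 1) = (i == j).
  move=> pz; have zj : z ^+ j != 0 by rewrite expf_neq0 // (prim_root_neq0 _ _ pz).
  rewrite -(inj_eq (mulIf zj)) divfK // mul1r (eq_prim_root_expr pz).
  by rewrite !modn_small.
rewrite -mulr_suml (sum_expr_unity _ _ pn) (sum_expr_unity _ _ q3).
rewrite (eq1 _ _ _ _ (omega_prim_two_n _ n0)) (eq1 _ _ _ _ zeta_prim).
case: x y {oxy p q E pn q3} => [x1 x2] [y1 y2]; rewrite xpair_eqE /=.
by do 2 case: eqP => _; rewrite ?mulr0 ?mul0r // natrM.
Qed.

(* Orthogonality on a parity class of exponents needs only n frequencies. *)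
Lemma fourier_inj (n : nat) (V : U n -> algC) : (0 < n)%N ->
  (forall (k : 'I_n) (c : 'I_3) (b : bool),
     \sum_(x : U n | odd x.1 == b) V x * phi n k c x = 0) ->
  forall y, V y = 0.
Proof.
move=> n0 V0 y; apply: (mulfI (_ : (n * 3)%:R != 0 :> algC)).
  by rewrite pnatr_eq0; lia.
(* Fourier inversion: the coefficients divided by [phi] at [y] sum to 3n times [V y]. *)
rewrite mulr0; transitivity (\sum_(k < n) \sum_(c < 3)
   (\sum_(x : U n | odd x.1 == odd y.1) V x * phi n k c x) / phi n k c y); last first.
  by rewrite big1 // => k _; rewrite big1 // => c _; rewrite V0 mul0r.
under eq_bigr => k _ do under eq_bigr => c _ do rewrite mulr_suml.
under eq_bigr => k _ do rewrite exchange_big.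
rewrite exchange_big /= (bigD1 y) //= [X in _ + X]big1 ?addr0.
  under eq_bigr => k _ do under eq_bigr => c _ do rewrite -mulrA.
  under eq_bigr => k _ do rewrite -mulr_sumr.
  by rewrite -mulr_sumr phi_orthogonality // eqxx mulrC.
move=> x /andP[/eqP oxy xy].
under eq_bigr => k _ do under eq_bigr => c _ do rewrite -mulrA.
under eq_bigr => k _ do rewrite -mulr_sumr.
by rewrite -mulr_sumr phi_orthogonality // (negPf xy) mulr0.
Qed.

(** Pairing a row eigenvector with the waves gives, for its half sums e and o over the two parities,
    (lam - D) e = q o and (lam - D) o = p e. If (lam - D)^2 differed from p q at all frequencies,
    all half sums would vanish, and with them the eigenvector. *)
Lemma eigenvalue_square (n : nat) (S : {set U n}) (lam : algC) :
  (0 < n)%N -> (forall m c, even_coef S m (2 * c) = even_coef S m c) ->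
  eigenvalue (cay_adj S) lam ->
  exists m : 'I_n, exists c : 'I_3,
    (lam - even_coef S m c) ^+ 2 = odd_coef S m c * odd_coef S m (2 * c).
Proof.
move=> n0 ev /eigenvalueP[v vA v0].
suff /existsP[m /existsP[c /eqP E]] : [exists m : 'I_n, exists c : 'I_3,
    (lam - even_coef S m c) ^+ 2 == odd_coef S m c * odd_coef S m (2 * c)].
  by exists m, c.
apply: contraNT v0; rewrite negb_exists => /forallP no.
pose V x := v 0 (enum_rank x).
suff V0 x : V x = 0.
  by apply/eqP/rowP => i; rewrite mxE -(V0 (enum_val i)) /V enum_valK.
apply: fourier_inj => // k c b {x}.
have {no} nokc : (lam - even_coef S k c) ^+ 2 != odd_coef S k c * odd_coef S k (2 * c).
  by have := no k; rewrite negb_exists => /forallP.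
pose half (b : bool) := \sum_(x : U n | odd x.1 == b) V x * phi n k c x.
have pair s t : (v *m wave_col n (wave n k c s t)) 0 0 = s * half false + t * half true.
  rewrite mxE; under eq_bigr => i _ do rewrite mxE -{1}(enum_valK i) -/(V (enum_val i)).
  rewrite -(big_enum_val (fun x => V x * wave n k c s t x)) /=.
  rewrite (bigID (fun x : U n => odd x.1)) addrC !mulr_sumr; congr (_ + _).
    by apply: eq_big => x; rewrite /wave /=; case: (odd x.1) => // _; rewrite mulrCA.
  by apply: eq_big => x; rewrite /wave /=; case: (odd x.1) => // _; rewrite mulrCA.
have key s t : lam * (s * half false + t * half true) =
    (s * even_coef S k c + t * odd_coef S k c) * half false +
    (s * odd_coef S k (2 * c) + t * even_coef S k c) * half true.
  rewrite -!pair -(cay_adj_wave _ _ _ _ _ _ (even_coef S k c)) //.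
  by rewrite mulmxA vA -scalemxAl [RHS]mxE.
have := key 1 0; have := key 0 1; rewrite !(mul1r, mul0r, add0r, addr0) => ho he.
move: nokc; rewrite -subr_eq0 => nokc.
rewrite -/(half b); apply: (mulfI nokc); rewrite mulr0.
set e := half false in ho he *; set o := half true in ho he *.
set D := even_coef S k c in ho he *.
set p := odd_coef S k c in ho he *.
set q := odd_coef S k _ in ho he *.
have ho' : (lam - D) * o = p * e by rewrite mulrBl ho addrK.
have he' : (lam - D) * e = q * o by rewrite mulrBl he addrC addKr.
case: b; rewrite -/e -/o mulrBl expr2 -mulrA ?ho' ?he' mulrCA ?ho' ?he' mulrA.
  by rewrite subrr.
by rewrite (mulrC q) subrr.
Qed.

(** * Integrality of algebraic integers *)

Lemma Aint_Cint_mul (k : nat) (x : algC) :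
  (0 < k)%N -> x \in Aint -> k%:R * x \in Num.int -> x \in Num.int.
Proof.
move=> k0 xA kx; apply: Cint_rat_Aint => //.
have k_neq0 : k%:R != 0 :> algC by rewrite pnatr_eq0 -lt0n.
rewrite -(mulKf k_neq0 x) rpredM ?rpredV ?rpred_nat //.
by have /intrP[z ->] := kx; rewrite rpred_int.
Qed.

(** The algebraic integer y is rational, hence an integer; then z is even, and x is z/2 up to
    sign. *)
Lemma quarter_square_Cint (x y : algC) (z : int) :
  x ^+ 2 = y -> y \in Aint -> 4 * y = (z ^+ 2)%:~R -> x \in Num.int.
Proof.
move=> xy yA yz.
have /intrP[t Et] : y \in Num.int.
  by apply: (Aint_Cint_mul 4) => //; rewrite yz rpred_int.
have {}yz : 4 * t = z ^+ 2.
  by apply/eqP; rewrite -(eqr_int algC) -yz Et rmorphM.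
have [q Eq] : exists q : int, z = 2 * q.
  exists (z %/ 2)%Z; have := divz_eq z 2.
  have := modz_ge0 z (isT : 2 != 0 :> int); have := ltz_pmod z (isT : 0 < 2 :> int).
  by move: (z %% 2)%Z (z %/ 2)%Z => r q; nia.
have : x ^+ 2 == q%:~R ^+ 2.
  have -> : x ^+ 2 = t%:~R by rewrite xy Et.
  by rewrite -rmorphXn eqr_int; apply/eqP; move: yz; rewrite Eq; lia.
by rewrite eqf_sqr => /orP[] /eqP ->; rewrite ?rpredN rpred_int.
Qed.

Lemma Aint_phi (n m c : nat) (x : U n) : (0 < n)%N -> phi n m c x \in Aint.
Proof.
move=> n0; rewrite rpredM // rpredX //.
  exact: Aint_prim_root (omega_prim_two_n _ n0).
exact: Aint_prim_root zeta_prim.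
Qed.

Lemma Aint_even_coef (n : nat) (S : {set U n}) (m c : nat) :
  (0 < n)%N -> even_coef S m c \in Aint.
Proof. by move=> n0; apply: rpred_sum => s _; exact: Aint_phi. Qed.

Lemma Aint_odd_coef (n : nat) (S : {set U n}) (m c : nat) :
  (0 < n)%N -> odd_coef S m c \in Aint.
Proof. by move=> n0; apply: rpred_sum => s _; exact: Aint_phi. Qed.

(** * Symmetries of the coefficients, and the characters psi *)

Lemma phi_half_period (n m c : nat) (x : U n) : (0 < n)%N ->
  phi n (m + n) c x = (-1) ^+ odd x.1 * phi n m c x.
Proof.
move=> n0; rewrite /phi mulnDl exprD (exprM _ n) omega_expn // signr_odd.
by rewrite mulrA [_ * (-1) ^+ _]mulrC.
Qed.

Lemma even_coef_half_period (n : nat) (S : {set U n}) (m c : nat) : (0 < n)%N ->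
  even_coef S (m + n) c = even_coef S m c.
Proof.
move=> n0; apply: eq_bigr => s /andP[_ /negPf os].
by rewrite phi_half_period // os mul1r.
Qed.

Lemma odd_coef_half_period (n : nat) (S : {set U n}) (m c : nat) : (0 < n)%N ->
  odd_coef S (m + n) c = - odd_coef S m c.
Proof.
move=> n0; rewrite -sumrN; apply: eq_bigr => s /andP[_ os].
by rewrite phi_half_period // os mulN1r.
Qed.

Lemma odd_coef_mod3 (n : nat) (S : {set U n}) (m c : nat) :
  odd_coef S m (c %% 3) = odd_coef S m c.
Proof.
apply: eq_bigr => s _; rewrite /phi; congr (_ * _).
by rewrite mulnC (expr_mulmod _ _ _ _ _ zeta_prim) mulnC.
Qed.

Lemma zeta_sum : 1 + zeta + zeta ^+ 2 = 0.
Proof.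
have := sum_expr_unity _ _ (prim_expr_order zeta_prim).
rewrite !big_ord_recl big_ord0 expr0 expr1 addr0 addrA.
by rewrite -(prim_order_dvd zeta_prim 1).
Qed.

(** For odd factors the product has b-exponent t = f - e modulo 3, and zeta^t + zeta^(-t) is 2 if t
    = 0 and -1 otherwise: these are the values of psi up to the power of [omega]. *)
Lemma psiU_mulU (n k : nat) (x y : U n) : (0 < n)%N -> odd x.1 -> odd y.1 ->
  psiU n k (mulU x y) = phi n k 1 x * phi n k 2 y + phi n k 2 x * phi n k 1 y.
Proof.
move=> n0 ox oy; rewrite /psiU odd_mulU ox oy /=.
rewrite (expr_mulmod _ _ _ _ _ (omega_prim_two_n _ n0)) mulnDr exprD.
rewrite /phi mulrACA [X in _ = _ + X]mulrACA -!mulrDr -!exprD.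
have z3 : zeta ^+ 3 = 1 := prim_expr_order zeta_prim.
have E m : zeta ^+ m = zeta ^+ (m %% 3) by rewrite (prim_expr_mod zeta_prim).
have z2 : zeta ^+ 2 = - 1 - zeta.
  by apply/eqP; rewrite -subr_eq0 -zeta_sum; apply/eqP; ring.
have := oy => ->; rewrite val_double_ord3.
case: (x.2) => [[|[|[|//]]] ?]; case: (y.2) => [[|[|[|//]]] ?] /=;
  rewrite [X in _ = _ * (X + _)]E [X in _ = _ * (_ + X)]E /= ?expr0 ?expr1 ?z2; ring.
Qed.

Lemma charS2_psiU (n k : nat) (S : {set U n}) : (0 < n)%N ->
  S \subset [set x : U n | odd x.1] ->
  charS2 (psiU n k) S = 2 * (odd_coef S k 1 * odd_coef S k 2).
Proof.
move=> n0 /subsetP So.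
have oS x : x \in S -> odd x.1 by move/So; rewrite inE.
have E c : odd_coef S k c = \sum_(x in S) phi n k c x.
  by apply: eq_bigl => x; case xS: (x \in S) => //=; exact: oS.
transitivity (\sum_(x in S) \sum_(y in S)
   (phi n k 1 x * phi n k 2 y + phi n k 2 x * phi n k 1 y)).
  by apply: eq_bigr => x /oS ox; apply: eq_bigr => y /oS oy; exact: psiU_mulU.
under eq_bigr => x _ do rewrite big_split -!mulr_sumr /= -!E.
by rewrite big_split -!mulr_suml -!E /=; ring.
Qed.

(** * Coefficients of the connection set *)

Definition even_pows {n : nat} (R : {set 'I_n}) : {set U n} :=
  [set apow n (2 * r)%N | r : 'I_n in R].

Definition connection_set {n : nat} (R L : {set 'I_n}) (S2 : {set U n}) : {set U n} :=
  even_pows R :|: [set apowb n (2 * l)%N 1 | l : 'I_n in L]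
    :|: [set apowb n (two_n n - 2 * l)%N 2 | l : 'I_n in L] :|: S2.

Lemma val_inZp_double (n : nat) (l : 'I_n) : (0 < n)%N ->
  (2 * l %% two_n n)%N = (2 * l)%N.
Proof. by move=> n0; rewrite modn_small // two_nE // ltn_pmul2l. Qed.

Lemma apowb_double_inj (n e : nat) : (0 < n)%N ->
  injective (fun l : 'I_n => apowb n (2 * l)%N e).
Proof.
move=> n0 l l' /(congr1 (fun x : U n => x.1 : nat)) /=.
by rewrite !val_inZp_double // => E; apply/val_inj; rewrite /=; lia.
Qed.

Lemma sum_setU_disjoint (T : finType) (A B : {set T}) (f : T -> algC) :
  [disjoint A & B] ->
  \sum_(x in A :|: B) f x = \sum_(x in A) f x + \sum_(x in B) f x.
Proof. by move=> AB; rewrite -bigU //; apply: eq_bigl => x; rewrite !inE. Qed.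

(** The three pieces are told apart by their b-exponents 0, 1, 2. The last one runs over the
    inverses of S_L, and S_L is closed under inversion, so it contributes the same rho sum as the
    second. *)
Lemma even_coef_connection (n : nat) (R L : {set 'I_n}) (S2 : {set U n}) (m c : nat) :
  (0 < n)%N -> S2 \subset [set x : U n | odd x.1] ->
  invS (even_pows L) = even_pows L ->
  even_coef (connection_set R L S2) m c =
  charS (rhoU n m) (even_pows R) +
  charS (rhoU n m) (even_pows L) * (zeta ^+ c + zeta ^+ (2 * c)).
Proof.
move=> n0 /subsetP S2o SLinv.
have oddN (l : 'I_n) : odd (two_n n - 2 * l) = false.
  rewrite oddB; last by rewrite two_nE // leq_pmul2l // ltnW.
  by rewrite two_nE // !mul2n !odd_double.
(* Inversion maps the finite set S_L onto itself, hence is injective on it. *)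
have inv_inj : {in L &, injective (fun l : 'I_n => invU (apow n (2 * l)))}.
  move=> l l' lL l'L /= E; apply: (apowb_double_inj _ 0 n0) => /=.
  have /imset_injP inj : #|invS (even_pows L)| == #|even_pows L| by rewrite SLinv.
  by apply: inj => //; apply: imset_f.
have apowb_inv (l : 'I_n) :
    (apowb n (two_n n - 2 * l) 2).1 = (invU (apow n (2 * l))).1.
  by apply/val_inj; rewrite /= val_inZp_double.
have neg_inj : {in L &, injective (fun l : 'I_n => apowb n (two_n n - 2 * l) 2)}.
  move=> l l' lL l'L /= E; apply: inv_inj => //; rewrite /invU; congr pair.
    by have := congr1 fst E; rewrite !apowb_inv.
  by rewrite /= !odd_modn_two_n !mul2n !odd_double.
rewrite /even_coef; transitivity (\sum_(s in even_pows R
    :|: [set apowb n (2 * l)%N 1 | l : 'I_n in L]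
    :|: [set apowb n (two_n n - 2 * l)%N 2 | l : 'I_n in L]) phi n m c s).
  apply: eq_bigl => s; rewrite /connection_set in_setU andb_orl.
  have -> : (s \in S2) && ~~ odd s.1 = false.
    by apply/negP => /andP[/S2o]; rewrite inE => ->.
  rewrite orbF; apply: andb_idr; rewrite !in_setU => /orP[/orP[]|] /imsetP[l _ ->];
    by rewrite /= odd_modn_two_n ?oddN // mul2n odd_double.
rewrite !sum_setU_disjoint.
- rewrite -addrA; congr (_ + _).
    apply: eq_bigr => s /imsetP[r _ ->].
    by rewrite /phi /rhoU /= mod0n muln0 mulr1.
  rewrite mulrDr; congr (_ + _).
    rewrite /charS !big_imset /=; last 2 first.
    + by move=> l l' _ _; exact: apowb_double_inj.
    + by move=> l l' _ _; exact: apowb_double_inj.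
    rewrite mulr_suml; apply: eq_bigr => l _; rewrite /phi /rhoU /=.
    by rewrite (modn_small (isT : (1 < 3)%N)) muln1.
  rewrite -[in RHS]SLinv /invS /even_pows -imset_comp /charS !big_imset //=.
  rewrite mulr_suml; apply: eq_bigr => l _.
  by rewrite /phi /rhoU apowb_inv (mulnC 2 c).
- rewrite disjoint_subset; apply/subsetP => x /imsetP[l _ ->]; rewrite inE.
  by apply/negP => /imsetP[l' _] /(congr1 (fun x : U n => x.2 : nat)).
- rewrite disjoint_subset; apply/subsetP => x xAB; rewrite inE.
  case/setUP: xAB => /imsetP[l _ ->];
  by apply/negP => /imsetP[l' _] /(congr1 (fun x : U n => x.2 : nat)).
Qed.

Lemma odd_coef_connection (n : nat) (R L : {set 'I_n}) (S2 : {set U n}) (m c : nat) :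
  (0 < n)%N -> odd_coef (connection_set R L S2) m c = odd_coef S2 m c.
Proof.
move=> n0; apply: eq_bigl => s; rewrite /connection_set !in_setU.
case: (s \in S2); rewrite ?orbT // orbF andFb.
apply/negP => /andP[/orP[/orP[]|] /imsetP[l _ ->]];
  rewrite /= odd_modn_two_n ?mul2n ?odd_double //.
rewrite oddB ?odd_double ?addbF; first by rewrite two_nE // mul2n odd_double.
by rewrite two_nE // mul2n leq_double ltnW.
Qed.

(** * The integrality criterion *)

Theorem theorem3p2 (n : nat) (R L : {set 'I_n}) (S2 : {set U n}) :
  (1 <= n)%N ->
  S2 \subset [set x : U n | odd x.1] ->
  let SR := [set apow n (2 * r)%N | r : 'I_n in R] in
  let SL := [set apow n (2 * l)%N | l : 'I_n in L] in
  let S1 := SR :|: [set apowb n (2 * l)%N 1 | l : 'I_n in L]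
                :|: [set apowb n (two_n n - 2 * l)%N 2 | l : 'I_n in L] in
  let S := S1 :|: S2 in
  oneU n \notin S ->
  invS S = S ->
  invS SL = SL ->
  integral_graph S <->
  ((forall j : nat, (j < 2 * n)%N ->
      3 * charS (rhoU n j) SR + charS (chiU n j) S2 \in Num.int /\
      3 * charS (rhoU n j) SL + charS (chiU n j) S2 \in Num.int) /\
   (forall k : nat, (k < n)%N -> is_square (2 * charS2 (psiU n k) S2))).
Proof.
move=> n0 S2o SR SL S1 S _ _ SLinv.
have evS m c : even_coef S m c = charS (rhoU n m) SR +
    charS (rhoU n m) SL * (zeta ^+ c + zeta ^+ (2 * c)).
  exact: even_coef_connection.
have odS m c : odd_coef S m c = odd_coef S2 m c by exact: odd_coef_connection.
have ev0 m : even_coef S m 0 = charS (rhoU n m) SR + 2 * charS (rhoU n m) SL.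
  by rewrite evS; ring.
have zeta12 : zeta + zeta ^+ 2 = -1.
  by apply/eqP; rewrite -addr_eq0 addrC addrA zeta_sum.
have ev1 m : even_coef S m 1 = charS (rhoU n m) SR - charS (rhoU n m) SL.
  by rewrite evS muln1 expr1 zeta12 mulrN1.
have ev2 m : even_coef S m 2 = even_coef S m 1.
  rewrite ev1 evS -(prim_expr_mod zeta_prim (2 * 2)) expr1 (addrC (zeta ^+ 2)).
  by rewrite zeta12 mulrN1.
have chi_od m : charS (chiU n m) S2 = odd_coef S m 0.
  rewrite odS; apply: eq_big => x; last by rewrite /phi expr0 mulr1.
  by apply/esym/andb_idr => /(subsetP S2o); rewrite inE.
have psi_od m : 2 * charS2 (psiU n m) S2 = 4 * (odd_coef S m 1 * odd_coef S m 2).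
  by rewrite charS2_psiU // !odS mulrA; congr (_ * _); ring.
split=> [Sint|[Hchi Hpsi]].
  (* For c = 0 both off-diagonal entries are the chi sum, and (1, 1) is an eigenvector. *)
  have Ichi m : even_coef S m 0 + charS (chiU n m) S2 \in Num.int.
    by rewrite chi_od; apply/Sint/(wave_eigenvalue _ _ m 0 1 1);
      rewrite ?oner_neq0 // mulrC.
  have Ipsi m : even_coef S m 1 \in Num.int /\
      exists z : int, odd_coef S m 1 * odd_coef S m 2 = (z ^+ 2)%:~R.
    (* Both D + mu and D - mu are eigenvalues; their sum 2 D is an integer, so the algebraic integer
       D is one, and then so is mu. *)
    pose mu := sqrtC (odd_coef S m 1 * odd_coef S m 2).
    have mu2 : mu ^+ 2 = odd_coef S m 1 * odd_coef S m 2 by exact: sqrtCK.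
    have Ip : even_coef S m 1 + mu \in Num.int.
      by apply/Sint/(square_eigenvalue _ _ m 1).
    have Im : even_coef S m 1 - mu \in Num.int.
      by apply/Sint/(square_eigenvalue _ _ m 1) => //; rewrite sqrrN.
    have ID : even_coef S m 1 \in Num.int.
      apply: (Aint_Cint_mul 2) => //; first exact: Aint_even_coef.
      by have := rpredD Ip Im; rewrite addrACA subrr addr0 mulr_natl.
    split=> //; have : mu \in Num.int.
      by have := rpredB Ip ID; rewrite addrC addKr.
    by move=> /intrP[z mz]; exists z; rewrite -mu2 mz rmorphXn.
  split=> [j _|k _].
    have [/= ID _] := Ipsi j; have IC := Ichi j.
    split.
      have -> : 3 * charS (rhoU n j) SR + charS (chiU n j) S2 =
        (even_coef S j 0 + charS (chiU n j) S2) + 2 * even_coef S j 1.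
        by rewrite ev0 ev1; ring.
      by rewrite rpredD // rpredM // rpred_nat.
    have -> : 3 * charS (rhoU n j) SL + charS (chiU n j) S2 =
      (even_coef S j 0 + charS (chiU n j) S2) - even_coef S j 1.
      by rewrite ev0 ev1; ring.
    by rewrite rpredB.
  have [_ [z Ez]] := Ipsi k; exists (2 * z).
  by rewrite psi_od Ez !rmorphXn rmorphM; ring.
(* The difference of the two sums in condition (1) is three times this coefficient. *)
have ID m : (m < 2 * n)%N -> even_coef S m 1 \in Num.int.
  move=> /Hchi[HR HL]; apply: (Aint_Cint_mul 3) => //; first exact: Aint_even_coef.
  by have := rpredB HR HL; rewrite ev1 mulrBr opprD addrACA subrr addr0.
have IC m : (m < 2 * n)%N -> even_coef S m 0 + odd_coef S m 0 \in Num.int.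
  move=> mn; have [_ HL] := Hchi m mn; rewrite -chi_od.
  have -> : even_coef S m 0 + charS (chiU n m) S2 =
    (3 * charS (rhoU n m) SL + charS (chiU n m) S2) + even_coef S m 1.
    by rewrite ev0 ev1; ring.
  by rewrite rpredD // ID.
have even_coef_sym m c : even_coef S m (2 * c) = even_coef S m c.
  rewrite !evS mulnA -(prim_expr_mod zeta_prim (2 * 2 * c)) -modnMml.
  by rewrite mul1n (prim_expr_mod zeta_prim) (addrC (zeta ^+ (2 * c))).
move=> lam /(eigenvalue_square _ _ _ n0 even_coef_sym)[m [c]].
have mn : (m < 2 * n)%N by rewrite mul2n -addnn ltn_addl.
have Isq x : x ^+ 2 = odd_coef S m 1 * odd_coef S m 2 -> x \in Num.int.
  move=> x2; have [z] := Hpsi m (ltn_ord m); rewrite psi_od.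
  by apply: quarter_square_Cint => //; rewrite rpredM // Aint_odd_coef.
case: c => [[|[|[|//]]] ?] /=.
- move/eqP; rewrite eqf_sqr !subr_eq => /orP[] /eqP ->.
    by rewrite addrC IC.
  (* The root D - u at frequency m is the root D + u at frequency m + n, which is why condition (1)
     is needed up to 2n. *)
  rewrite addrC -odd_coef_half_period // -(even_coef_half_period _ S m 0 n0) IC //.
  by rewrite mul2n -addnn ltn_add2r.
- by move/Isq => I; rewrite -(subrK (even_coef S m 1) lam) rpredD // ID.
(* The frequency c = 2 repeats c = 1 with the two odd coefficients exchanged, as 4 = 1 modulo 3. *)
- rewrite ev2 -(odd_coef_mod3 _ _ _ (2 * 2)) mulrC => /Isq I.
  by rewrite -(subrK (even_coef S m 1) lam) rpredD // ID.
Qed.
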